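(* Let $\mathscr{A}$ be a nonempty compact $\mathcal{H}$-set of positive $(N\times N)$-matrices, let $\nu(\cdot)$ be a coordinate-wise monotone function, let $x\in\mathbb{R}^N$, $x>0$, and let $n>1$ be an integer. There exist matrices $A^{(max)}_1,\ldots,A^{(max)}_n\in\mathscr{A}$ constructed sequentially so that, with $x_0=x$ and $x_k=A^{(max)}_k\cdots A^{(max)}_1x$ for $k=1,\ldots,n-1$, for each $k=0,1,\ldots,n-1$ one has $$A x_k\le A^{(max)}_{k+1}x_k\quad\text{for all }A\in\mathscr{A},$$ and for any matrices $A^{(max)}_1,\ldots,A^{(max)}_n$ so constructed the following hold. (i) The maximum of $\nu(A_n\cdots A_1x)$ over $A_1,\ldots,A_n\in\mathscr{A}$ is attained at $A^{(max)}_1,\ldots,A^{(max)}_n$, that is, $$\max_{A_n,\ldots,A_1\in\mathscr{A}}\nu(A_n\cdots A_1x)=\nu\bigl(A^{(max)}_n\cdots A^{(max)}_1x\bigr).$$ (ii) If the maximum of $\nu(A_n\cdots A_1x)$ over $A_n,\ldots,A_1\in\mathscr{A}$ is attained at matrices $\tilde A_1,\ldots,\tilde A_n\in\mathscr{A}$ and the function $\nu(\cdot)$ is strictly coordinate-wise monotone, then $$\tilde A_i\cdots\tilde A_1x=A^{(max)}_i\cdots A^{(max)}_1x,\qquad i=1,2,\ldots,n.$$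
   Context: For vectors $x,y\in\mathbb{R}^N$, write $x\ge y$ (resp. $x>y$) if every coordinate of $x$ is not less than (resp. strictly greater than) the corresponding coordinate of $y$. A matrix is positive if all its entries are strictly positive. Sets of matrices carry the topology of element-wise convergence. A set $\mathscr{A}$ of positive matrices of a common size is called an $\mathcal{H}$-set if for every $\tilde A\in\mathscr{A}$ and every vector $x>0$ both of the following hold: (H1) either $Ax\ge\tilde Ax$ for all $A\in\mathscr{A}$, or there exists $\bar A\in\mathscr{A}$ with $\bar Ax\le\tilde Ax$ and $\bar Ax\ne\tilde Ax$; (H2) either $Ax\le\tilde Ax$ for all $A\in\mathscr{A}$, or there exists $\bar A\in\mathscr{A}$ with $\bar Ax\ge\tilde Ax$ and $\bar Ax\neq\tilde Ax$. A real function $\nu(x)=\nu(x_1,\ldots,x_N)$ defined for all $x_1,\ldots,x_N\ge 0$ is coordinate-wise monotone if it is non-decreasing in each coordinate $x_i$, and strictly coordinate-wise monotone if it is strictly increasing in each variable $x_i$. *)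

(* Defs.v *)
From mathcomp Require Import all_boot all_order all_algebra.
From mathcomp Require Import all_classical all_reals all_analysis.

Set Implicit Arguments.
Unset Strict Implicit.
Unset Printing Implicit Defensive.

Import Order.TTheory GRing.Theory Num.Theory.
Import numFieldNormedType.Exports.

Local Open Scope classical_set_scope.
Local Open Scope ring_scope.

(* [vlt] is strict in every coordinate; it is not the strict part of [vle]. *)
Definition vle (R : realType) (N : nat) (x y : 'cV[R]_N) : Prop :=
  forall i, x i 0 <= y i 0.

Definition vlt (R : realType) (N : nat) (x y : 'cV[R]_N) : Prop :=
  forall i, x i 0 < y i 0.

Definition positive_mx (R : realType) (N : nat) (A : 'M[R]_N) : Prop :=
  forall i j, 0 < A i j.

Definition H_set (R : realType) (N : nat) (calA : set 'M[R]_N) : Prop :=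
  (forall A, calA A -> positive_mx A) /\
  forall (At : 'M[R]_N) (x : 'cV[R]_N), calA At -> vlt 0 x ->
    ((forall A, calA A -> vle (At *m x) (A *m x)) \/
     (exists Ab, [/\ calA Ab, vle (Ab *m x) (At *m x)
                  & Ab *m x <> At *m x]))
    /\
    ((forall A, calA A -> vle (A *m x) (At *m x)) \/
     (exists Ab, [/\ calA Ab, vle (At *m x) (Ab *m x)
                  & Ab *m x <> At *m x])).

(* A function on the nonnegative orthant is represented by a total function
   about which nothing is assumed outside the orthant. The variable [i] is
   increased while all the other coordinates are kept fixed. *)
Definition cw_monotone (R : realType) (N : nat) (nu : 'cV[R]_N -> R) : Prop :=
  forall (x y : 'cV[R]_N) (i : 'I_N), vle 0 x -> vle 0 y ->
    (forall j, j != i -> x j 0 = y j 0) ->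
    x i 0 <= y i 0 -> nu x <= nu y.

Definition strictly_cw_monotone (R : realType) (N : nat)
    (nu : 'cV[R]_N -> R) : Prop :=
  forall (x y : 'cV[R]_N) (i : 'I_N), vle 0 x -> vle 0 y ->
    (forall j, j != i -> x j 0 = y j 0) ->
    x i 0 < y i 0 -> nu x < nu y.

(* For A = [:: A_1; ...; A_n] and k <= n, [lprod A k] is A_k *m ... *m A_1:
   later matrices multiply on the left. *)
Definition lprod (R : realType) (N : nat) (A : seq 'M[R]_N) (k : nat) :
    'M[R]_N :=
  foldl (fun P B => B *m P) 1%:M (take k A).

(* [tnth A k] is A_{k+1}. *)
Definition max_sequence (R : realType) (N n : nat) (calA : set 'M[R]_N)
    (x : 'cV[R]_N) (Amax : n.-tuple 'M[R]_N) : Prop :=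
  forall k : 'I_n, calA (tnth Amax k) /\
    forall A, calA A ->
      vle (A *m (lprod Amax k *m x)) (tnth Amax k *m (lprod Amax k *m x)).

Definition max_attained_at (R : realType) (N n : nat) (calA : set 'M[R]_N)
    (nu : 'cV[R]_N -> R) (x : 'cV[R]_N) (A : n.-tuple 'M[R]_N) : Prop :=
  (forall k, calA (tnth A k)) /\
  forall B : n.-tuple 'M[R]_N, (forall k, calA (tnth B k)) ->
    nu (lprod B n *m x) <= nu (lprod A n *m x).

(* Main.v *)
(** Since [calA] is compact, some [A] maximises the coordinate sum of [A x];
    by (H2) such an [A] dominates every other [A' x] coordinatewise, since a
    vector above [A x] and different from it would have a larger sum. This
    gives the greedy sequence, and because positive matrices preserve the
    order, the greedy trajectory dominates every other one. For uniqueness, a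
    positive matrix separates comparable distinct vectors in every coordinate,
    so equality of the final vectors propagates backwards along the
    trajectories. *)

Require Import Defs.
From mathcomp Require Import all_boot all_order all_algebra.
From mathcomp Require Import all_classical all_reals all_analysis.

Set Implicit Arguments.
Unset Strict Implicit.
Unset Printing Implicit Defensive.

Import Order.TTheory GRing.Theory Num.Theory.
Import numFieldNormedType.Exports.

Local Open Scope classical_set_scope.
Local Open Scope ring_scope.

Lemma vle_trans (R : realType) (N : nat) (y x z : 'cV[R]_N) :
  vle x y -> vle y z -> vle x z.
Proof. by move=> xy yz i; exact: le_trans (xy i) (yz i). Qed.

Lemma vltW (R : realType) (N : nat) (x y : 'cV[R]_N) : vlt x y -> vle x y.
Proof. by move=> xy i; exact: ltW. Qed.

Lemma vle_neq_lt (R : realType) (N : nat) (x y : 'cV[R]_N) :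
  vle x y -> x <> y -> exists i, x i 0 < y i 0.
Proof.
move=> xy /eqP nxy; apply/existsP; apply: contraNT nxy => /existsPn nlt.
apply/eqP/colP => i; apply/eqP; rewrite eq_le xy /= leNgt; exact: nlt.
Qed.

Lemma vle_mulmx (R : realType) (N : nat) (A : 'M[R]_N) (x y : 'cV[R]_N) :
  positive_mx A -> vle x y -> vle (A *m x) (A *m y).
Proof.
move=> A0 xy i; rewrite !mxE; apply: ler_sum => j _.
by rewrite ler_wpM2l// ltW.
Qed.

(** A gap in one coordinate [j] enters every row [i] with the weight [A i j], which is positive. *)
Lemma vlt_mulmx (R : realType) (N : nat) (A : 'M[R]_N) (x y : 'cV[R]_N) :
  positive_mx A -> vle x y -> x <> y -> vlt (A *m x) (A *m y).
Proof.
move=> A0 xy nxy i; have [j xyj] := vle_neq_lt xy nxy.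
rewrite !mxE (bigD1 j)//= [ltRHS](bigD1 j)//=; apply: ltr_leD.
  by rewrite ltr_pM2l.
by apply: ler_sum => k _; rewrite ler_wpM2l// ltW.
Qed.

Lemma vlt0_mulmx (R : realType) (N : nat) (hN : (0 < N)%N) (A : 'M[R]_N)
    (x : 'cV[R]_N) :
  positive_mx A -> vlt 0 x -> vlt 0 (A *m x).
Proof.
move=> A0 x0; rewrite -(mulmx0 _ A); apply: vlt_mulmx => //; first exact: vltW.
by move=> xE; have := x0 (Ordinal hN); rewrite -xE ltxx.
Qed.

Lemma H_set_max (R : realType) (N : nat) (calA : set 'M[R]_N)
    (x : 'cV[R]_N) :
  calA !=set0 -> compact calA -> H_set calA -> vlt 0 x ->
  exists A, calA A /\ forall B, calA B -> vle (B *m x) (A *m x).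
Proof.
move=> hA0 hAc [_ hAH] x0.
(* The coordinate sum of [A *m x], expanded so that its continuity in the entries of [A] is
   visible. *)
pose f (A : 'M[R]_N) := \sum_i \sum_j A i j * x j 0.
have fE A : f A = \sum_i (A *m x) i 0.
  by apply: eq_bigr => i _; rewrite mxE.
have cf : continuous f.
  apply: (continuous_big (@add_continuous R)) => i _.
  apply: (continuous_big (@add_continuous R)) => j _ A.
  by apply: continuousM; [exact: coord_continuous | exact: cst_continuous].
have [A] := compact_EVT_max hA0 hAc (continuous_subspaceT cf).
rewrite inE => AA maxA; exists A; split=> //.
have [_ [//|[B [BA AB nBA]]]] := hAH _ _ AA x0.
have [i ABi] := vle_neq_lt AB (nesym nBA).
have : f B <= f A by apply: maxA; rewrite inE.
rewrite !fE leNgt => /negP[].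
rewrite (bigD1 i)//= [ltRHS](bigD1 i)//=; apply: ltr_leD => //.
exact: ler_sum.
Qed.

Lemma lprodS_mul (R : realType) (N n : nat) (A : n.-tuple 'M[R]_N)
    (k : 'I_n) (x : 'cV[R]_N) :
  lprod A k.+1 *m x = tnth A k *m (lprod A k *m x).
Proof.
rewrite /lprod (take_nth (tnth_default A k)) ?size_tuple//.
by rewrite -tnth_nth -cats1 foldl_cat /= mulmxA.
Qed.

Lemma lprod0_mul (R : realType) (N : nat) (A : seq 'M[R]_N) (x : 'cV[R]_N) :
  lprod A 0 *m x = x.
Proof. by rewrite /lprod take0 mul1mx. Qed.

Lemma lprod_mul_gt0 (R : realType) (N n : nat) (hN : (0 < N)%N)
    (A : n.-tuple 'M[R]_N) (x : 'cV[R]_N) :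
  (forall k, positive_mx (tnth A k)) -> vlt 0 x ->
  forall k, (k <= n)%N -> vlt 0 (lprod A k *m x).
Proof.
move=> A0 x0; elim=> [|k IH] kn; first by rewrite lprod0_mul.
by rewrite (lprodS_mul _ (Ordinal kn)); apply: vlt0_mulmx => //; exact/IH/ltnW.
Qed.

Lemma exists_max_sequence (R : realType) (N n : nat) (hN : (0 < N)%N)
    (calA : set 'M[R]_N) (x : 'cV[R]_N) :
  calA !=set0 -> compact calA -> H_set calA -> vlt 0 x ->
  exists Amax : n.-tuple 'M[R]_N, max_sequence calA x Amax.
Proof.
move=> hA0 hAc hAH x0.
have /choice[f fP] : forall y : 'cV[R]_N, exists A, vlt 0 y ->
    calA A /\ forall B, calA B -> vle (B *m y) (A *m y).
  (* The choice function must be total; the value [0] at vectors that are not positive is a dummy,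
     as the trajectory [X] below stays positive. *)
  move=> y; have [y0|] := pselect (vlt 0 y); last by exists 0.
  by have [A ?] := H_set_max hA0 hAc hAH y0; exists A.
pose X k := iter k (fun y => f y *m y) x.
have X0 k : vlt 0 (X k).
  elim: k => [//|k IH]; apply: vlt0_mulmx => //.
  by apply: hAH.1; exact: (fP _ IH).1.
exists [tuple f (X k) | k < n].
have XE k : (k <= n)%N -> lprod [tuple f (X k) | k < n] k *m x = X k.
  elim: k => [|k IH] kn; first by rewrite lprod0_mul.
  by rewrite (lprodS_mul _ (Ordinal kn)) tnth_mktuple /= IH// ltnW.
move=> k; rewrite XE; last exact: ltnW.
by rewrite tnth_mktuple; exact: fP.
Qed.

(** Each step compares through an intermediate vector: the matrix of [B] applied to the greedy
    vector. Positivity gives the lower comparison, the greedy choice the upper one. *)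
Lemma max_sequence_ge (R : realType) (N n : nat) (calA : set 'M[R]_N)
    (x : 'cV[R]_N) (Amax B : n.-tuple 'M[R]_N) :
  (forall A, calA A -> positive_mx A) ->
  max_sequence calA x Amax -> (forall k, calA (tnth B k)) ->
  forall k, (k <= n)%N -> vle (lprod B k *m x) (lprod Amax k *m x).
Proof.
move=> pA maxA BA; elim=> [|k IH] kn; first by rewrite !lprod0_mul => i.
rewrite !(lprodS_mul _ (Ordinal kn)).
apply: vle_trans ((maxA (Ordinal kn)).2 _ (BA _)).
by apply: vle_mulmx; [exact: pA | exact/IH/ltnW].
Qed.

(** If the vectors differed at time [k], the matrix of [B] would make the gap strict in every
    coordinate, and the greedy choice could only widen it. One coordinate, supplied by [hN], gives
    the contradiction. *)
Lemma max_sequence_eq_pred (R : realType) (N n : nat) (hN : (0 < N)%N)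
    (calA : set 'M[R]_N) (x : 'cV[R]_N) (Amax B : n.-tuple 'M[R]_N)
    (k : 'I_n) :
  (forall A, calA A -> positive_mx A) ->
  max_sequence calA x Amax -> (forall k, calA (tnth B k)) ->
  lprod B k.+1 *m x = lprod Amax k.+1 *m x ->
  lprod B k *m x = lprod Amax k *m x.
Proof.
move=> pA maxA BA; rewrite !lprodS_mul => eqS; apply: contrapT => neq.
have le_k := max_sequence_ge pA maxA BA (ltnW (ltn_ord k)).
have lt_k := vlt_mulmx (pA _ (BA k)) le_k neq (Ordinal hN).
have := (maxA k).2 _ (BA k) (Ordinal hN).
by rewrite -eqS leNgt lt_k.
Qed.

Lemma cw_monotone_vle (R : realType) (N : nat) (nu : 'cV[R]_N -> R)
    (x y : 'cV[R]_N) :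
  cw_monotone nu -> vle 0 x -> vle x y -> nu x <= nu y.
Proof.
move=> hnu x0 xy.
have y0 : vle 0 y := vle_trans x0 xy.
(* A path from [x] to [y] inside the orthant: passing from [z k] to [z k.+1] raises only coordinate
   [k]. *)
pose z k : 'cV[R]_N := \col_i (if (i < k)%N then y i 0 else x i 0).
have z0 k : vle 0 (z k).
  by move=> i; rewrite [leRHS]mxE; case: ifP => _; [exact: y0 | exact: x0].
have -> : y = z N by apply/colP => i; rewrite mxE ltn_ord.
suff H k : (k <= N)%N -> nu x <= nu (z k) by exact: H.
elim: k => [|k IH] kN.
  by have -> : z 0%N = x by apply/colP => i; rewrite mxE.
apply: le_trans (IH (ltnW kN)) _.
apply: (hnu _ _ (Ordinal kN)) => // [j|]; rewrite !mxE ?ltnS ?leqnn ?ltnn//.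
by rewrite -val_eqE /= ltn_neqAle => ->.
Qed.

Lemma strictly_cw_monotone_vle (R : realType) (N : nat) (nu : 'cV[R]_N -> R)
    (x y : 'cV[R]_N) :
  cw_monotone nu -> strictly_cw_monotone nu ->
  vle 0 x -> vle x y -> x <> y -> nu x < nu y.
Proof.
move=> hnu snu x0 xy nxy; have [i xyi] := vle_neq_lt xy nxy.
(* Raising coordinate [i] alone gives the strict increase; going on from [z] to [y] needs only weak
   monotonicity. *)
pose z : 'cV[R]_N := \col_j (if j == i then y j 0 else x j 0).
have xz : vle x z by move=> j; rewrite [leRHS]mxE; case: ifP.
have zy : vle z y by move=> j; rewrite [leLHS]mxE; case: ifP.
have z0 : vle 0 z := vle_trans x0 xz.
apply: lt_le_trans (cw_monotone_vle hnu z0 zy).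
apply: (snu _ _ i) => // [j /negbTE ji|]; rewrite mxE ?ji//.
by rewrite eqxx.
Qed.

Theorem theorem5 (R : realType) (N : nat) (hN : (0 < N)%N)
    (calA : set 'M[R]_N) (hA0 : calA !=set0) (hAc : compact calA)
    (hAH : H_set calA)
    (nu : 'cV[R]_N -> R) (hnu : cw_monotone nu)
    (x : 'cV[R]_N) (hx : vlt 0 x)
    (n : nat) (hn : (1 < n)%N) :
  (exists Amax : n.-tuple 'M[R]_N, max_sequence calA x Amax) /\
  (forall Amax : n.-tuple 'M[R]_N, max_sequence calA x Amax ->
     max_attained_at calA nu x Amax /\
     (forall At : n.-tuple 'M[R]_N,
        max_attained_at calA nu x At -> strictly_cw_monotone nu ->
        forall i : nat, (1 <= i <= n)%N ->
          lprod At i *m x = lprod Amax i *m x)).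
Proof.
split; first exact: exists_max_sequence.
have pA := hAH.1.
move=> Amax maxA.
have AmaxA k : calA (tnth Amax k) := (maxA k).1.
have ge0 (B : n.-tuple 'M[R]_N) : (forall k, calA (tnth B k)) ->
    vle 0 (lprod B n *m x).
  by move=> BA; apply/vltW/lprod_mul_gt0 => // k; exact: pA.
split.
  split=> // B BA; apply: cw_monotone_vle => //; first exact: ge0.
  exact: (max_sequence_ge pA maxA BA (leqnn n)).
move=> At [AtA maxAt] snu i /andP[_ lein].
(* The greedy final vector dominates; were it different, strictness of [nu] would contradict the
   maximality of [At]. *)
have eq_n : lprod At n *m x = lprod Amax n *m x.
  apply: contrapT => neq; have := maxAt _ AmaxA; rewrite leNgt => /negP; apply.
  apply: strictly_cw_monotone_vle => //; first exact: ge0.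
  exact: (max_sequence_ge pA maxA AtA (leqnn n)).
(* Backward induction on the distance [d] from the end; index [i] is reached at [d = n - i]. *)
suff back d : (d <= n)%N ->
    lprod At (n - d)%N *m x = lprod Amax (n - d)%N *m x.
  by rewrite -(subKn lein); apply: back; exact: leq_subr.
elim: d => [|d IH] dn; first by rewrite subn0.
(* The step goes from time [n - d] back to its predecessor [n - d.+1]. *)
have kn : (n - d.+1 < n)%N by rewrite ltn_subrL (leq_trans _ dn).
apply: (@max_sequence_eq_pred _ _ _ hN calA x Amax At (Ordinal kn)) => //=.
by rewrite subnSK// IH// ltnW.
Qed.
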